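(* Let $\Gamma$ be a finite, simple, connected, undirected graph with vertex set $X$ and adjacency matrix $A$. Let $x\in X$ and let $\pi_x=\{\mathcal{P}_0,\mathcal{P}_1,\ldots,\mathcal{P}_r\}$, with $\mathcal{P}_0=\{x\}$, be an $x$-distance-faithful intersection diagram of $\Gamma$ with $r+1$ cells. Let $w_{ij}$ denote the number of walks of length $i$ ($0\le i\le r$) from $y$ to $x$ for any $y\in\mathcal{P}_j$ ($0\le j\le r$), and let $P=[w_{ij}]_{0\le i,j\le r}$. If $\Gamma$ has the same $x$-distance-faithful intersection diagram around every vertex $x\in X$, then $\Gamma$ has exactly $\operatorname{rank}(P)$ distinct eigenvalues. Moreover, if $\operatorname{rank}(P)=r+1$, then $\Gamma$ is a quotient-polynomial graph.
   Context: An $x$-distance-faithful intersection diagram is the intersection diagram of an equitable partition $\{\mathcal{P}_0=\{x\},\ldots,\mathcal{P}_r\}$ of $X$ refining the distance partition around $x$ (all vertices of a cell are at the same distance from $x$); equitable means the number $c_{ij}$ of neighbours in $\mathcal{P}_j$ of a vertex in $\mathcal{P}_i$ depends only on $i,j$. ''The same around every vertex'' means that for every vertex $u$ there is such a partition $\{\mathcal{P}_0(u)=\{u\},\ldots,\mathcal{P}_r(u)\}$ with the same cell sizes, the same distances of cells from the base vertex, and the same parameters $c_{ij}$. Quotient-polynomial: let $\Gamma$ have $d+1$ distinct eigenvalues and for $y,z\in X$ let $\mathbf{w}(y,z)=((A^0)_{yz},(A^1)_{yz},\ldots,(A^d)_{yz})^\top$. The walk-regular partition of $X\times X$ is the partition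 $\{R_0,\ldots,R_s\}$ into classes where $(y,z),(u,v)$ lie in the same class iff $\mathbf{w}(y,z)=\mathbf{w}(u,v)$; $M_i$ is the $(0,1)$ adjacency matrix of $R_i$. $\Gamma$ is quotient-polynomial if every $M_i$ lies in $\operatorname{span}\{I,A,\ldots,A^d\}$. *)

(* Defs.v *)
From HB Require Import structures.
From mathcomp Require Import all_boot all_order all_algebra.

Set Implicit Arguments.
Unset Strict Implicit.
Unset Printing Implicit Defensive.

Import GRing.Theory.
Local Open Scope ring_scope.

(* A walk y = y_0, y_1, ..., y_k is encoded by its start y and the k-tuple
   (y_1, ..., y_k). *)
Definition num_walks (X : finType) (e : rel X) (k : nat) (y z : X) : nat :=
  #|[set p : k.-tuple X | path e y p && (last y p == z)]|.

(* The least length of a walk from y to z; it is #|X| when there is no such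
   walk, which does not happen in a connected graph. *)
Definition gdist (X : finType) (e : rel X) (y z : X) : nat :=
  find (fun k => 0 < num_walks e k y z)%N (iota 0 #|X|).

(* The numerical data displayed by an intersection diagram with r + 1 cells:
   the size of each cell, its distance from the base vertex, and the numbers
   c_ij of neighbours in the j-th cell of a vertex of the i-th cell. *)
Record diagram (r : nat) := Diagram {
  cell_size : 'I_r.+1 -> nat;
  cell_dist : 'I_r.+1 -> nat;
  cell_nbrs : 'I_r.+1 -> 'I_r.+1 -> nat
}.

(* Injectivity of P makes it list r + 1 distinct cells; these are nonempty
   since [partition] excludes the empty block. *)
Record distance_faithful (X : finType) (e : rel X) (x : X) (r : nat)
    (P : 'I_r.+1 -> {set X}) (D : diagram r) : Prop := DistanceFaithful {
  df_inj : injective P;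
  df_partition : partition [set P i | i : 'I_r.+1] [set: X];
  df_base : P ord0 = [set x];
  df_size : forall i, #|P i| = cell_size D i;
  df_dist : forall i y, y \in P i -> gdist e x y = cell_dist D i;
  df_equitable : forall i j y, y \in P i ->
    #|[set z in P j | e y z]| = cell_nbrs D i j
}.

(* w_ij is computed from an arbitrary vertex of the (nonempty) j-th cell; the
   choice is immaterial by [walk_mxE] below. *)
Definition walk_mx (R : nzRingType) (X : finType) (e : rel X) (x : X) (r : nat)
    (P : 'I_r.+1 -> {set X}) : 'M[R]_r.+1 :=
  \matrix_(i, j)
    (if [pick y in P j] is Some y then num_walks e i y x else 0%N)%:R.

Definition adj_mx (R : nzRingType) (X : finType) (e : rel X) : 'M[R]_#|X| :=
  \matrix_(i, j) (e (enum_val i) (enum_val j))%:R.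

Definition num_eigenvalues (F : fieldType) (n : nat) (A : 'M[F]_n) (k : nat) :
    Prop :=
  exists s : seq F,
    [/\ uniq s, forall a, (a \in s) = eigenvalue A a & size s = k].

Definition walk_vec (R : nzRingType) (X : finType) (e : rel X) (d : nat)
    (yz : X * X) : 'cV[R]_d.+1 :=
  \col_(i < d.+1) (adj_mx R e ^+ i) (enum_rank yz.1) (enum_rank yz.2).

Definition walk_regular_partition (R : nzRingType) (X : finType) (e : rel X)
    (d : nat) : {set {set X * X}} :=
  preim_partition (walk_vec R e d) [set: X * X].

Definition rel_mx (R : nzRingType) (X : finType) (C : {set X * X}) :
    'M[R]_#|X| :=
  \matrix_(i, j) ((enum_val i, enum_val j) \in C)%:R.

Definition quotient_polynomial (F : fieldType) (X : finType) (e : rel X) :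
    Prop :=
  exists2 d : nat, num_eigenvalues (adj_mx F e) d.+1 &
    forall C, C \in walk_regular_partition F e d ->
      rel_mx F C \in <<[tuple adj_mx F e ^+ i | i < d.+1]>>%VS.

Lemma num_walks0 (X : finType) (e : rel X) (y z : X) :
  num_walks e 0 y z = (y == z).
Proof.
rewrite /num_walks; case: eqP => [->|yz].
  apply/eqP/cards1P; exists [tuple]; apply/setP => p.
  by rewrite !inE tuple0 /= !eqxx.
by apply/eqP; rewrite cards_eq0 -subset0; apply/subsetP => p; rewrite !inE tuple0 /= => /eqP.
Qed.

Lemma num_walksS (X : finType) (e : rel X) (k : nat) (y z : X) :
  num_walks e k.+1 y z = (\sum_(u | e y u) num_walks e k u z)%N.
Proof.
rewrite /num_walks -sum1_card (partition_big (@thead k X) (e y)) /=; last first.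
  by move=> p; rewrite inE; case/tupleP: p => u p /= /andP[/andP[]].
apply: eq_bigr => u yu; rewrite -sum1_card.
rewrite (reindex_onto (fun p : k.-tuple X => [tuple of u :: p])
  (fun p => [tuple of behead p])) /=.
  apply: eq_bigl => p; rewrite !inE /= theadE eqxx andbT yu /=.
  rewrite -[RHS]andbT; congr (_ && _).
  by apply/eqP; apply: val_inj.
by move=> p /andP[_ /eqP <-]; rewrite [RHS]tuple_eta; apply: val_inj.
Qed.

Lemma walk_mxE (R : nzRingType) (X : finType) (e : rel X) (x : X) (r : nat)
    (P : 'I_r.+1 -> {set X}) (D : diagram r) :
  distance_faithful e x P D ->
  forall (i j : 'I_r.+1) y, y \in P j ->
    walk_mx R e x P i j = (num_walks e i y x)%:R.
Proof.
move=> dfP; have [injP partP P0 _ _ eqP'] := dfP.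
have [covP trivP _] := and3P partP.
have cellE y : exists j, y \in P j.
  have: y \in cover [set P i | i : 'I_r.+1] by rewrite (eqP covP) inE.
  by case/bigcupP=> _ /imsetP[j _ ->]; exists j.
have cell_uniq y i j : y \in P i -> y \in P j -> i = j.
  move=> yi yj; apply: injP; have inim k : P k \in [set P i | i : 'I_r.+1].
    exact: imset_f.
  by rewrite -(def_pblock trivP (inim i) yi) (def_pblock trivP (inim j) yj).
have main k : forall j y z, y \in P j -> z \in P j ->
    num_walks e k y x = num_walks e k z x.
  elim: k => [|k IHk] j y z yj zj.
    rewrite !num_walks0 -!in_set1 -P0.
    case: (boolP (y \in P ord0)) => y0.
      by rewrite (cell_uniq _ _ _ y0 yj) zj.
    case: (boolP (z \in P ord0)) => // z0.
    by move: y0; rewrite (cell_uniq _ _ _ z0 zj) yj.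
  have part v : v \in P j -> num_walks e k.+1 v x = (\sum_(l < r.+1)
      cell_nbrs D j l * if [pick u in P l] is Some u then num_walks e k u x else 0)%N.
    move=> vj; rewrite num_walksS.
    rewrite (eq_bigr (fun u => \sum_(l < r.+1 | u \in P l) num_walks e k u x)%N).
      rewrite (exchange_big_dep predT) //=; apply: eq_bigr => l _.
      rewrite -(eqP' _ l _ vj) -sum1_card big_distrl /=.
      rewrite [RHS](eq_bigl (fun u => e v u && (u \in P l))); last first.
        by move=> u; rewrite inE andbC.
      apply: eq_bigr => u /andP[_ ul]; rewrite mul1n.
      by case: pickP => [u' u'l|/(_ u)]; [apply: (IHk l)|rewrite ul].
    move=> u _; have [l ul] := cellE u; rewrite (big_pred1 l) // => l'.
    by apply/idP/eqP => [/cell_uniq|->//]; apply.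
  by rewrite !part.
move=> i j y yj; rewrite mxE; case: pickP => [y' y'j|/(_ y)]; last by rewrite yj.
by rewrite (main _ _ _ _ y'j yj).
Qed.

(* Main.v *)
(** The number of walks of length [k] from a vertex of the [j]-th cell around
    [u] to [u] depends only on the diagram, not on [u].  Hence
    [A^k = sum_j w_kj M_j], where [M_j] is the adjacency matrix of the relation
    "[y] lies in the [j]-th cell around [u]".  The [M_j] are linearly
    independent, so the span of [I, A, ..., A^r] has dimension [rank P] and all
    powers of [A] span a space of dimension at most [r + 1]: the minimal
    polynomial of [A] has degree [rank P], and as [A] is real symmetric this is
    the number of its distinct eigenvalues.  If [P] is invertible, its columns
    are distinct, so the walk-regular classes are the relations above, and
    inverting [P] expresses each [M_j] as a polynomial in [A]. *)
Require Import Defs.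
From mathcomp Require Import all_boot all_order all_algebra.
From mathcomp Require Import sesquilinear spectral complex.

Set Implicit Arguments.
Unset Strict Implicit.
Unset Printing Implicit Defensive.

Import Order.TTheory GRing.Theory Num.Theory.
Local Open Scope ring_scope.

(** Over [R[i]] the matrix is Hermitian, hence unitarily diagonalizable with real spectrum. Its
    minimal polynomial there has simple real roots, and it is the image of the one over [R]. *)
Lemma mxminpoly_symmetric_split (R : rcfType) (n : nat) (A : 'M[R]_n.+1) :
  A^T = A ->
  exists2 s : seq R, uniq s & mxminpoly A = \prod_(a <- s) ('X - a%:P).
Proof.
move=> symA; pose f : {rmorphism R -> R[i]} := real_complex R.
pose B := map_mx f A.
have realB : B \is a mxOver Num.real.
  by apply/mxOverP => i j; rewrite mxE; apply/complex_realP; exists (A i j).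
have symB : B \is symmetricmx.
  by apply/is_hermitianmxP; rewrite expr0 scale1r map_mx_id // map_trmx symA.
have hermB := realsym_hermsym symB realB.
have /orthomx_spectralP Beq := hermitian_normalmx hermB.
have /mxOverP reald := hermitian_spectral_diag_real hermB.
have unitP := spectral_unit B.
have diagB : diagonalizable_for (spectralmx B) B.
  apply/(diagonalizable_forLR unitP); exists (spectral_diag B).
  by rewrite mxpoly.conjVmx.
have minB := diagonalizable_for_mxminpoly unitP diagB.
set rs := undup _ in minB.
have real_rs a : a \in rs -> exists b, a = f b.
  (* The roots are the diagonal entries of [B] conjugated by [spectralmx B], that is, entries of
     [spectral_diag B]. *)
  rewrite mem_undup => /mapP[i _ ->]; apply/complex_realP.
  rewrite [X in mxpoly.conjmx _ X]Beq -mxpoly.conjVmx // mxpoly.conjmxVK // mxE eqxx mulr1n.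
  exact: reald.
pose s := [seq complex.Re a | a <- rs].
have rsE : rs = map f s.
  rewrite -map_comp -[LHS]map_id; apply/eq_in_map => a.
  by case/real_rs=> b ->.
exists s; first by apply: (@map_uniq _ _ f); rewrite -rsE undup_uniq.
apply: (map_poly_inj f); rewrite -mxminpoly_map -/B minB rsE map_prod_XsubC.
by rewrite big_map.
Qed.

(** The powers below the degree of the minimal polynomial form a basis of the algebra generated by
    [A], so further powers add no rank. *)
Lemma mxrank_powers_mx (F : fieldType) (n : nat) (A : 'M[F]_n.+1) (k : nat) :
  (degree_mxminpoly A <= k)%N -> \rank (powers_mx A k) = degree_mxminpoly A.
Proof.
move=> le_dk; rewrite -[RHS](eqP (minpoly_mx_free A)).
apply: eqmx_rank; apply/andP; split; apply/row_subP => i; rewrite rowK.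
  by have := horner_mx_mem A 'X^i; rewrite rmorphXn /= horner_mx_X.
by apply: (eq_row_sub (widen_ord le_dk i)); rewrite rowK.
Qed.

(* [powers_mx] of mxpoly.v is only available in positive dimension [n.+1],
   whereas [adj_mx] has dimension [#|X|]. *)
Definition mx_powers (F : fieldType) (n : nat) (A : 'M[F]_n) (k : nat) :
    'M[F]_(k, n * n) :=
  \matrix_(i < k) mxvec (A ^+ i).

Lemma num_eigenvalues_symmetric (R : rcfType) (n : nat) (A : 'M[R]_n) (k : nat) :
  (0 < n)%N -> A^T = A -> (forall m, \rank (mx_powers A m) <= k)%N ->
  num_eigenvalues A (\rank (mx_powers A k)).
Proof.
case: n A => // n A _ symA rank_le; rewrite -[mx_powers A k]/(powers_mx A k).
have [s uniq_s minA] := mxminpoly_symmetric_split symA.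
exists s; split=> // [a|]; first by rewrite eigenvalue_root_min minA root_prod_XsubC.
(* The rank bound is used at [m = degree_mxminpoly A], where the powers are independent: the degree
   is at most [k]. *)
rewrite mxrank_powers_mx; last by rewrite -(eqP (minpoly_mx_free A)); apply: rank_le.
by apply: succn_inj; rewrite -size_mxminpoly minA size_prod_XsubC.
Qed.

Lemma adj_mxX (R : nzRingType) (X : finType) (e : rel X) (k : nat) (y z : X) :
  (adj_mx R e ^+ k) (enum_rank y) (enum_rank z) = (num_walks e k y z)%:R.
Proof.
elim: k y => [|k IHk] y.
  by rewrite expr0 num_walks0 mxE (inj_eq enum_rank_inj).
rewrite exprS num_walksS mxE natr_sum.
rewrite (reindex_onto enum_rank enum_val) /=; last by move=> i _; rewrite enum_valK.
rewrite [RHS]big_mkcond; apply: eq_big => [u|u _]; first by rewrite enum_rankK eqxx.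
by rewrite IHk mxE !enum_rankK; case: (e y u); rewrite ?mul1r ?mul0r.
Qed.

(** Recursion on the first step of a walk to the base vertex. No vertex occurs in it, so the counts
    agree around all base vertices. *)
Fixpoint diagram_walks (r : nat) (D : diagram r) (k : nat) (j : 'I_r.+1) : nat :=
  if k is k'.+1 then (\sum_(l < r.+1) cell_nbrs D j l * diagram_walks D k' l)%N
  else j == ord0.

Section Cells.

Variables (X : finType) (e : rel X) (x : X) (r : nat).
Variables (P : 'I_r.+1 -> {set X}) (D : diagram r).
Hypothesis dfP : distance_faithful e x P D.

Lemma cell_exists (y : X) : exists j, y \in P j.
Proof.
have [covP _ _] := and3P (df_partition dfP).
have: y \in cover [set P i | i : 'I_r.+1] by rewrite (eqP covP) inE.
by case/bigcupP=> _ /imsetP[j _ ->]; exists j.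
Qed.

Lemma mem_cell (y : X) (i j : 'I_r.+1) : y \in P i -> (y \in P j) = (i == j).
Proof.
move=> yi; apply/idP/eqP => [yj|<- //]; apply: (df_inj dfP).
have [_ trivP _] := and3P (df_partition dfP).
rewrite -(def_pblock trivP (imset_f P _) yi) //.
by rewrite (def_pblock trivP (imset_f P _) yj).
Qed.

Lemma cell_nonempty (j : 'I_r.+1) : exists y, y \in P j.
Proof.
have [_ _ nP] := and3P (df_partition dfP).
by apply/set0Pn; apply: contraNneq nP => <-; apply: imset_f.
Qed.

Lemma num_walks_diagram (k : nat) (j : 'I_r.+1) (y : X) :
  y \in P j -> num_walks e k y x = diagram_walks D k j.
Proof.
elim: k j y => [|k IHk] j y yj.
  by rewrite num_walks0 -in_set1 -(df_base dfP) (mem_cell _ yj).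
rewrite num_walksS /=.
rewrite (eq_bigr (fun u => \sum_(l < r.+1 | u \in P l) diagram_walks D k l)%N).
  rewrite (exchange_big_dep predT) //=; apply: eq_bigr => l _.
  rewrite sum_nat_const -(df_equitable dfP l yj); congr (_ * _)%N.
  by apply: eq_card => u; rewrite !inE andbC.
move=> u _; have [l ul] := cell_exists u; rewrite (IHk l) // (big_pred1 l) // => l'.
by rewrite (mem_cell _ ul) eq_sym.
Qed.

End Cells.

(** The number of rows is left free: [k = r.+1] gives the matrix P, while arbitrary [k] serves to
    bound the rank of all powers of the adjacency matrix. *)
Definition diagram_walk_mx (R : nzRingType) (r : nat) (D : diagram r) (k : nat) :
    'M[R]_(k, r.+1) :=
  \matrix_(i, j) (diagram_walks D i j)%:R.

Lemma walk_mx_diagram (R : nzRingType) (X : finType) (e : rel X) (x : X)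
    (r : nat) (P : 'I_r.+1 -> {set X}) (D : diagram r) :
  distance_faithful e x P D -> walk_mx R e x P = diagram_walk_mx R D r.+1.
Proof.
move=> dfP; apply/matrixP => i j; have [y yj] := cell_nonempty dfP j.
by rewrite (walk_mxE R dfP _ yj) (num_walks_diagram dfP _ yj) mxE.
Qed.

Section SameDiagram.

Variables (F : fieldType) (X : finType) (e : rel X) (r : nat) (D : diagram r).
Variable Q : X -> 'I_r.+1 -> {set X}.
Hypothesis dfQ : forall u, distance_faithful e u (Q u) D.

Definition cell_rel (j : 'I_r.+1) : {set X * X} := [set p | p.1 \in Q p.2 j].

Lemma adj_mxX_cell_rel (k : nat) :
  adj_mx F e ^+ k = \sum_j (diagram_walks D k j)%:R *: rel_mx F (cell_rel j).
Proof.
apply/matrixP => a b; rewrite summxE -[a]enum_valK -[b]enum_valK adj_mxX.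
set y := enum_val a; set u := enum_val b.
have [j yj] := cell_exists (dfQ u) y.
rewrite (num_walks_diagram (dfQ u) _ yj) (bigD1 j) //= big1 ?addr0.
  by rewrite !mxE !enum_rankK inE yj mulr1.
move=> l lj; rewrite !mxE !enum_rankK inE (mem_cell (dfQ u) _ yj).
by rewrite eq_sym (negPf lj) mulr0.
Qed.

Definition cell_rels_mx : 'M[F]_(r.+1, #|X| * #|X|) :=
  \matrix_j mxvec (rel_mx F (cell_rel j)).

Lemma powers_adj_mx (k : nat) :
  mx_powers (adj_mx F e) k = diagram_walk_mx F D k *m cell_rels_mx.
Proof.
apply/row_matrixP => i; rewrite rowK row_mul mulmx_sum_row adj_mxX_cell_rel.
by rewrite linear_sum; apply: eq_bigr => j _; rewrite linearZ /= rowK !mxE.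
Qed.

Lemma cell_rels_mx_free (x : X) : row_free cell_rels_mx.
Proof.
have [y yP] := fin_all_exists (cell_nonempty (dfQ x)).
apply/row_freeP.
(* This right inverse reads off the entries at [(y j, x)]: among the relations, only the [j]-th
   contains that pair. *)
exists (\matrix_(p, j) (p == mxvec_index (enum_rank (y j)) (enum_rank x))%:R).
apply/matrixP => i j; rewrite !mxE.
rewrite (bigD1 (mxvec_index (enum_rank (y j)) (enum_rank x))) //= big1 ?addr0.
  rewrite !mxE eqxx mulr1 mxvecE mxE !enum_rankK inE /=.
  by rewrite (mem_cell (dfQ x) _ (yP j)) eq_sym.
by move=> p pn; rewrite [X in _ * X]mxE (negPf pn) mulr0.
Qed.

Lemma walk_vecE (y u : X) (j : 'I_r.+1) :
  y \in Q u j -> walk_vec F e r (y, u) = col j (diagram_walk_mx F D r.+1).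
Proof.
move=> yj; apply/matrixP => i b.
by rewrite !mxE adj_mxX (num_walks_diagram (dfQ u) _ yj).
Qed.

Hypothesis walk_unit : diagram_walk_mx F D r.+1 \in unitmx.

Lemma walk_regular_partition_cell_rel (C : {set X * X}) :
  C \in walk_regular_partition F e r -> exists j, C = cell_rel j.
Proof.
case/imsetP=> -[y u] _ ->; have [j yj] := cell_exists (dfQ u) y.
exists j; apply/setP => -[z v]; rewrite !inE /=.
have [l zl] := cell_exists (dfQ v) z.
rewrite (walk_vecE yj) (walk_vecE zl) (mem_cell (dfQ v) _ zl) eq_sym.
(* An invertible matrix has distinct columns, so walk vectors separate the cells. *)
apply/eqP/eqP => [|-> //]; rewrite !colE => /(can_inj (mulKmx walk_unit)).
move/matrixP/(_ l 0); rewrite !mxE !eqxx /= andbT => /eqP.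
by case: (l =P j) => // _; rewrite oner_eq0.
Qed.

Lemma rel_mx_cell_rel_span (j : 'I_r.+1) :
  rel_mx F (cell_rel j) \in <<[tuple adj_mx F e ^+ i | i < r.+1]>>%VS.
Proof.
pose W := diagram_walk_mx F D r.+1.
(* The coefficients solve the linear system of [adj_mxX_cell_rel] for [k] from 0 to [r]. *)
have -> : rel_mx F (cell_rel j) = \sum_i invmx W j i *: adj_mx F e ^+ i.
  transitivity (\sum_l (invmx W *m W) j l *: rel_mx F (cell_rel l)).
    rewrite mulVmx // (bigD1 j) //= big1 ?addr0 => [|l lj].
      by rewrite mxE eqxx scale1r.
    by rewrite mxE eq_sym (negPf lj) scale0r.
  under eq_bigr do rewrite mxE scaler_suml.
  rewrite exchange_big; apply: eq_bigr => i _ /=.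
  rewrite adj_mxX_cell_rel scaler_sumr; apply: eq_bigr => l _.
  by rewrite scalerA [W i l]mxE.
apply: memv_suml => i _; apply/memvZ/memv_span/mapP; exists i => //.
by rewrite mem_enum.
Qed.

End SameDiagram.

Theorem theorem1p4 (R : rcfType) (X : finType) (e : rel X)
    (e_sym : symmetric e) (e_irrefl : irreflexive e)
    (e_conn : forall y z : X, connect e y z)
    (x : X) (r : nat) (P : 'I_r.+1 -> {set X}) (D : diagram r)
    (x_diagram : distance_faithful e x P D)
    (same_diagram : forall u : X,
       exists Pu : 'I_r.+1 -> {set X}, distance_faithful e u Pu D) :
  num_eigenvalues (adj_mx R e) (\rank (walk_mx R e x P)) /\
  (\rank (walk_mx R e x P) = r.+1 -> quotient_polynomial R e).
Proof.
have [Q dfQ] := fin_all_exists same_diagram.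
have rankE k :
    \rank (mx_powers (adj_mx R e) k) = \rank (diagram_walk_mx R D k).
  by rewrite (powers_adj_mx R dfQ) mxrankMfree // (cell_rels_mx_free R dfQ x).
have adjT : (adj_mx R e)^T = adj_mx R e.
  by apply/matrixP => a b; rewrite !mxE e_sym.
have X_gt0 : (0 < #|X|)%N by apply/card_gt0P; exists x.
have eigE : num_eigenvalues (adj_mx R e) (\rank (walk_mx R e x P)).
  rewrite (walk_mx_diagram R x_diagram) -rankE.
  (* The uniform bound is the number [r.+1] of columns, one per cell. *)
  by apply: num_eigenvalues_symmetric => // m; rewrite rankE rank_leq_col.
split=> // rankP; exists r; first by rewrite -rankP.
have unitW : diagram_walk_mx R D r.+1 \in unitmx.
  by rewrite -row_full_unit /row_full -(walk_mx_diagram R x_diagram) rankP.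
move=> C /(walk_regular_partition_cell_rel dfQ unitW)[j ->].
exact: rel_mx_cell_rel_span.
Qed.
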